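(* Let $\mathcal L$ be the generator of a primitive symmetric quantum Markov semigroup on $\mathcal B(\mathcal H)$, $\dim\mathcal H=d$, with carré du champ operator $\Gamma$. Suppose that for every $p\in(1,2]$ the $p$-Beckner inequality holds with constant $\alpha_p$ and $\inf_{p\in(1,2]}\alpha_p\ge a$ for some $a>0$. Let $\kappa=(1-e^{-1/2})^{-1}$. Then for every self-adjoint $X\in\mathcal B(\mathcal H)$, $$\Big\|\exp\Big(\Big|X-\tfrac1d\mathrm{Tr}(X)\mathbf 1\Big|\Big)\Big\|_{1,\mathbf 1/d}\ \le\ 2\exp\Big(\frac{e\,\kappa\,\|\Gamma(X)\|_\infty}{4a}\Big),$$ and, for every $t>0$, $$\frac1d\mathrm{Tr}\Big(1_{[t,\infty)}\Big(\Big|X-\tfrac1d\mathrm{Tr}(X)\mathbf 1\Big|\Big)\Big)\ \le\ 2\exp\Big(-\frac{a\,t^2}{e\,\kappa\,\|\Gamma(X)\|_\infty}\Big).$$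
   Context: $\mathcal H$ is a finite-dimensional Hilbert space of dimension $d$. A quantum Markov semigroup (QMS) is a $C_0$-semigroup $\mathcal P_t=e^{t\mathcal L}$ of completely positive unital maps on $\mathcal B(\mathcal H)$; it is symmetric if $\mathcal P_t=\mathcal P_t^\dagger$ (adjoint for the Hilbert–Schmidt inner product), in which case $\mathbf 1/d$ is invariant; it is primitive if it has a unique invariant state and this is full rank (here $\mathbf 1/d$). The carré du champ is $\Gamma(X,Y)=\frac12\big(\mathcal L(X^*Y)-X^*\mathcal L(Y)-\mathcal L(X)^*Y\big)$ and $\Gamma(X)=\Gamma(X,X)$. $\|\cdot\|_\infty$ is the operator norm and $\|X\|_{p,\mathbf 1/d}=\big(\frac1d\mathrm{Tr}(|X|^p)\big)^{1/p}$. $1_{[t,\infty)}(\cdot)$ is the spectral projection (functional calculus), and $e$ in the exponents is Euler's number. For $p\in(1,2]$, $\hat p=p/(p-1)$ and $X\ge0$ let $\mathcal E_{p,\mathcal L}(X)=-\frac{\hat p\,p}{4}\cdot\frac1d\mathrm{Tr}\big(X^{p-1}\mathcal L(X)\big)$. The $p$-Beckner inequality with constant $\alpha_p$ is $\alpha_p\,\hat p\,\big(\|X\|_{p,\mathbf 1/d}^p-\|X\|_{1,\mathbf 1/d}^p\big)\le\mathcal E_{p,\mathcal L}(X)$ for all $X>0$. *)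

(* Defs.v *)
From HB Require Import structures.
From mathcomp Require Import all_boot all_order all_algebra.
From mathcomp Require Import sesquilinear spectral.
From mathcomp Require Import all_classical all_reals all_analysis.
From mathcomp Require Import complex.

Set Implicit Arguments.
Unset Strict Implicit.
Unset Printing Implicit Defensive.

Import Order.TTheory GRing.Theory Num.Theory Num.Def.
Import numFieldNormedType.Exports.

Local Open Scope classical_set_scope.
Local Open Scope ring_scope.
Local Open Scope complex_scope.
Local Open Scope sesquilinear_scope.

(* The Hilbert space is C^d with C = R[i], and B(H) is 'M[R[i]]_d. *)

Section Operators.
Variable R : realType.
Notation C := R[i].

(* The order of R[i] is partial: 0 <= z means that z is real and nonnegative,
   so the positivity of the quadratic form implies that A is self-adjoint. *)
Definition psdmx n (A : 'M[C]_n) : Prop :=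
  forall v : 'cV[C]_n, 0 <= (v^t* *m A *m v) 0 0.

Definition pdmx n (A : 'M[C]_n) : Prop :=
  forall v : 'cV[C]_n, v != 0 -> 0 < (v^t* *m A *m v) 0 0.

Definition vnorm n (v : 'cV[C]_n) : R :=
  Num.sqrt (\sum_i Normc.normc (v i 0) ^+ 2).

Definition opnorm n (A : 'M[C]_n) : R :=
  sup [set vnorm (A *m v) | v in [set v : 'cV[C]_n | vnorm v <= 1]].

(* Functional calculus; meaningful for self-adjoint A, whose spectral
   decomposition is A = U^-1 diag(lambda) U with U unitary, lambda real. *)
Definition fcalc (f : R -> R) n (A : 'M[C]_n) : 'M[C]_n :=
  invmx (spectralmx A)
  *m diag_mx (map_mx (fun z : C => (f (complex.Re z))%:C) (spectral_diag A))
  *m spectralmx A.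

Definition absmx n (A : 'M[C]_n) : 'M[C]_n := fcalc Num.sqrt (A^t* *m A).

(* Only applied to operators with a real trace. *)
Definition ntrace n (A : 'M[C]_n) : R := n%:R^-1 * complex.Re (\tr A).

Definition pnorm (p : R) n (A : 'M[C]_n) : R :=
  ntrace (fcalc (fun x => x `^ p) (absmx A)) `^ p^-1.

End Operators.

Section QuantumMarkovSemigroups.
Variables (R : realType) (d : nat).
Notation C := R[i].
Notation BH := 'M[C]_d.

Definition completely_positive (Phi : BH -> BH) : Prop :=
  forall (n : nat) (X : 'I_n -> 'I_n -> BH),
    psdmx (\mxblock_(i < n, j < n) X i j) ->
    psdmx (\mxblock_(i < n, j < n) Phi (X i j)).

(* The semigroup is indexed by t >= 0; the values P t for t < 0 are junk. *)
Record is_qms (P : R -> {linear BH -> BH}) : Prop := IsQMS {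
  qms_id : forall X, P 0 X = X;
  qms_add : forall s t, 0 <= s -> 0 <= t -> forall X, P (s + t) X = P s (P t X);
  qms_cont : forall X, opnorm (P t X - X) @[t --> 0^'+] --> (0 : R);
  qms_cp : forall t, 0 <= t -> completely_positive (P t);
  qms_unital : forall t, 0 <= t -> P t 1%:M = 1%:M }.

Definition is_generator (P : R -> {linear BH -> BH}) (L : BH -> BH) : Prop :=
  forall X, opnorm ((t^-1)%:C *: (P t X - X) - L X) @[t --> 0^'+] --> (0 : R).

Definition qms_symmetric (P : R -> {linear BH -> BH}) : Prop :=
  forall t, 0 <= t -> forall X Y : BH,
    \tr ((P t X)^t* *m Y) = \tr (X^t* *m P t Y).

Definition is_state (sigma : BH) : Prop := psdmx sigma /\ \tr sigma = 1.

Definition invariant_state (P : R -> {linear BH -> BH}) (sigma : BH) : Prop :=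
  is_state sigma /\
  forall t, 0 <= t -> forall X, \tr (sigma *m P t X) = \tr (sigma *m X).

Definition qms_primitive (P : R -> {linear BH -> BH}) : Prop :=
  exists sigma : BH,
    [/\ invariant_state P sigma,
        \rank sigma = d &
        forall tau, invariant_state P tau -> tau = sigma].

Definition carre_du_champ (L : BH -> BH) (X Y : BH) : BH :=
  2^-1 *: (L (X^t* *m Y) - X^t* *m L Y - (L X)^t* *m Y).

Definition hatp (p : R) : R := p / (p - 1).

Definition dirichlet_form (p : R) (L : BH -> BH) (X : BH) : R :=
  - (hatp p * p / 4) * ntrace (fcalc (fun x => x `^ (p - 1)) X *m L X).

Definition beckner (p : R) (L : BH -> BH) (alpha : R) : Prop :=
  forall X : BH, pdmx X ->
    alpha * hatp p * (pnorm p X `^ p - pnorm 1 X `^ p) <= dirichlet_form p L X.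

End QuantumMarkovSemigroups.

(* Main.v *)
Require Import Defs.
From HB Require Import structures.
From mathcomp Require Import all_boot all_order all_algebra.
From mathcomp Require Import sesquilinear spectral.
From mathcomp Require Import ring lra.
From mathcomp Require Import all_classical all_reals all_analysis.
From mathcomp Require Import complex.

Set Implicit Arguments.
Unset Strict Implicit.
Unset Printing Implicit Defensive.

Import Order.TTheory GRing.Theory Num.Theory Num.Def.
Import numFieldNormedType.Exports.

(** The statement is about operators, but only one commutative algebra is
    involved: functions of [X]. Let [u_i] be an eigenbasis of [X], with
    eigenvalues [x_i] and eigenprojections [E_i]. The numbers
    [c_ij = <u_i, L(E_j) u_i>] are the rates of a classical Markov chain:
    positivity of the semigroup gives [c_ij >= 0] off the diagonal
    ([rate_ge0]), unitality gives zero row sums ([rate_sum0]) and symmetry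
    gives [c_ij = c_ji] ([rate_sym]). For functions of [X] the Dirichlet form
    is that of the chain, and the diagonal entries of the carre du champ are
    [<u_i, Gamma(X) u_i> = 1/2 sum_j c_ij (x_i - x_j)^2]
    ([dentry_carre_du_champ]), which are at most the operator norm [G] of
    [Gamma(X)]. So it is enough to treat the chain.

    For the chain, put [z = x - mean x] and [M(s) = mean (exp (s z))]. The
    Beckner inequality for the function [exp (s z / p)] compares [M(s)] with
    [M(s/p)^p]. Since [(e^u - 1)(e^v - 1) <= u v (e^(u+v) + 1)] when [u] and
    [v] have the same sign, its right-hand side is at most a multiple of
    [(p - 1) s^2 G M(s)], whence
      [(1 - (p - 1) s^2 G / (2 a p)) M(s) <= M(s/p)^p]  ([mgf_contraction]).
    For [p] close enough to 1 this says that [ln M(s) / s - (G / a) s] does not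
    decrease when [s] is divided by [p] ([ln_mgf_contraction]). Dividing
    repeatedly drives [s] to 0, where this quantity is bounded above by a
    vanishing one because [z] has mean zero. Hence [M(s) <= exp (s^2 G / a)]
    ([mgf_le]): this is the Herbst argument with a difference equation in place
    of a differential one, and it replaces the usual estimate of all moments.

    Since [e kappa >= 4] ([e_kappa_ge4]), the bound is at least as good as the
    one claimed. Applied to [z] and [-z] it controls [exp |z|], and the tail
    estimate is Chernoff's bound. *)

Local Open Scope classical_set_scope.
Local Open Scope ring_scope.

(** * Elementary inequalities for the exponential *)

Section Exponential.
Variable R : realType.
Implicit Types u v x : R.

Lemma expRB1_le u : expR u - 1 <= u * expR u.
Proof.
have h := expR_ge1Dx (- u); rewrite expRN in h.
have := expR_gt0 u => e0.
have : (1 + - u) * expR u <= 1 by rewrite -ler_pdivlMr// mul1r.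
lra.
Qed.

(** Plays the role of the chain rule, which fails for jump processes: it turns
    the product of two increments of exponentials into a squared increment of
    the exponent. *)
Lemma mulr_expRB1_le u v : 0 <= u * v ->
  (expR u - 1) * (expR v - 1) <= u * v * (expR (u + v) + 1).
Proof.
have pos x y : 0 <= x -> 0 <= y ->
    (expR x - 1) * (expR y - 1) <= x * y * (expR (x + y) + 1).
  move=> x0 y0; rewrite expRD.
  have hx : 0 <= expR x - 1 by have := expR_ge1Dx x; lra.
  have hy : 0 <= expR y - 1 by have := expR_ge1Dx y; lra.
  apply: (le_trans (ler_pM hx hy (expRB1_le x) (expRB1_le y))).
  have := mulr_ge0 x0 y0; have := expR_ge0 x; have := expR_ge0 y; nra.
have neg x y : x <= 0 -> y <= 0 ->
    (expR x - 1) * (expR y - 1) <= x * y * (expR (x + y) + 1).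
  move=> x0 y0.
  have hx : 0 <= 1 - expR x by rewrite subr_ge0 expR_le1.
  have hy : 0 <= 1 - expR y by rewrite subr_ge0 expR_le1.
  have hx' : 1 - expR x <= - x by have := expR_ge1Dx x; lra.
  have hy' : 1 - expR y <= - y by have := expR_ge1Dx y; lra.
  have h := ler_pM hx hy hx' hy'.
  have hxy : 0 <= x * y by nra.
  have := mulr_ge0 hxy (expR_ge0 (x + y)).
  lra.
move=> uv; have [u0|u0] := leP 0 u; have [v0|v0] := leP 0 v.
- exact: pos.
- have : u * v = 0 by apply/eqP; rewrite eq_le uv andbT; nra.
  move/eqP; rewrite mulf_eq0 => /orP[/eqP->|/eqP v00]; last by rewrite v00 ltxx in v0.
  by rewrite expR0 subrr !mul0r.
- have : u * v = 0 by apply/eqP; rewrite eq_le uv andbT; nra.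
  move/eqP; rewrite mulf_eq0 => /orP[/eqP u00|/eqP->]; first by rewrite u00 ltxx in u0.
  by rewrite expR0 subrr !mulr0 mul0r.
- by apply: neg; exact: ltW.
Qed.

Lemma expR_le1D_sq x : expR x <= 1 + x + x ^+ 2 * expR `|x|.
Proof.
have h := expRB1_le x; rewrite expr2.
have [x0|x0] := leP 0 x.
  by rewrite ger0_norm//; have := ler_wpM2l x0 h; lra.
rewrite ltr0_norm//.
have h1 := expR_ge1Dx x.
have h2 : 1 <= expR (- x) by have := expR_ge1Dx (- x); lra.
have xx : 0 <= x * x by nra.
have := ler_wpM2l xx h2; nra.
Qed.

Lemma expRN_le1B x : 0 <= x -> x <= 2^-1 -> expR (- (2 * x)) <= 1 - x.
Proof.
move=> x0 x2; rewrite expRN.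
have h := expR_ge1Dx (2 * x).
rewrite invf_ple ?posrE ?expR_gt0 //; last by lra.
apply: le_trans h; rewrite -[leLHS]mul1r ler_pdivrMr; nra.
Qed.

End Exponential.

(** * Dirichlet forms of symmetric Markov chains *)

Section Mean.
Variables (R : realType) (n : nat).
Implicit Types (f g w z : 'I_n -> R) (c : 'I_n -> 'I_n -> R).

Definition mean f : R := n%:R^-1 * \sum_i f i.

(** The Dirichlet form, with respect to the uniform measure, of the chain with
    jump rates [c i j] for [i != j] and [c i i] minus the total rate. *)
Definition chain_form c f g : R := - mean (fun i => f i * \sum_j c i j * g j).

Lemma le_mean f g : (forall i, f i <= g i) -> mean f <= mean g.
Proof. by move=> h; rewrite ler_wpM2l ?invr_ge0// ler_sum. Qed.

Lemma meanZ k f : mean (fun i => k * f i) = k * mean f.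
Proof. by rewrite /mean -mulr_sumr mulrCA. Qed.

Lemma meanD f g : mean (fun i => f i + g i) = mean f + mean g.
Proof. by rewrite /mean big_split/= mulrDr. Qed.

Lemma mean1 : (0 < n)%N -> mean (fun=> 1) = 1.
Proof.
by move=> n0; rewrite /mean sumr_const card_ord mulVf// pnatr_eq0 -lt0n.
Qed.

Lemma mean_gt0 f : (0 < n)%N -> (forall i, 0 < f i) -> 0 < mean f.
Proof.
move=> n0 f0; rewrite mulr_gt0 ?invr_gt0 ?ltr0n//.
rewrite (bigD1 (Ordinal n0))//= ltr_pwDl//.
by apply: sumr_ge0 => i _; exact: ltW.
Qed.

(** Summation by parts for a reversible generator: the zero row sums allow the
    squares to be completed. *)
Lemma chain_formE c f g :
  (forall i j, c i j = c j i) -> (forall i, \sum_j c i j = 0) ->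
  chain_form c f g =
  mean (fun i => \sum_j c i j * ((f i - f j) * (g i - g j))) / 2.
Proof.
move=> cC c0; rewrite /chain_form /mean -mulrN -mulrA; congr (_ * _).
have e i : \sum_j c i j * ((f i - f j) * (g i - g j)) =
    - (f i * \sum_j c i j * g j) - (g i * \sum_j c i j * f j)
    + \sum_j c i j * (f j * g j).
  transitivity (f i * g i * (\sum_j c i j) - (f i * \sum_j c i j * g j)
      - (g i * \sum_j c i j * f j) + \sum_j c i j * (f j * g j)).
    rewrite !mulr_sumr -!sumrN -!big_split; apply: eq_bigr => j _ /=; ring.
  by rewrite c0 mulr0 sub0r.
under [in RHS]eq_bigr => i _ do rewrite e.
rewrite !big_split/= !sumrN.
have -> : \sum_i g i * (\sum_j c i j * f j) = \sum_i f i * (\sum_j c i j * g j).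
  under eq_bigr => i _ do rewrite mulr_sumr.
  rewrite exchange_big/=; apply: eq_bigr => i _; rewrite mulr_sumr.
  apply: eq_bigr => j _; rewrite (cC i j); ring.
have -> : \sum_i (\sum_j c i j * (f j * g j)) = 0.
  rewrite exchange_big/= big1// => j _.
  by rewrite -mulr_suml; under eq_bigr => i _ do rewrite cC; rewrite c0 mul0r.
by field.
Qed.

(** Each edge contributes both endpoint values of [exp ((b + 1) w)]; by symmetry
    of [c] the two halves have the same sum, and each vertex then carries its
    squared gradient, which [K] bounds. *)
Lemma chain_form_exp c w (b K : R) :
  (forall i j, c i j = c j i) -> (forall i j, i != j -> 0 <= c i j) ->
  (forall i, \sum_j c i j = 0) ->
  (forall i, \sum_j c i j * (w i - w j) ^+ 2 <= K) -> 0 <= b ->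
  chain_form c (fun i => expR (b * w i)) (fun i => expR (w i))
  <= b * K * mean (fun i => expR ((b + 1) * w i)).
Proof.
move=> cC c0 cs cK b0; rewrite chain_formE//.
pose E i := expR ((b + 1) * w i).
(* Factoring out the exponentials at [j] leaves increments in [s = w i - w j]. *)
have step i j :
    c i j * ((expR (b * w i) - expR (b * w j)) * (expR (w i) - expR (w j)))
    <= b * (c i j * (w i - w j) ^+ 2 * E i) + b * (c i j * (w i - w j) ^+ 2 * E j).
  have [->|ij] := eqVneq i j; first by rewrite !subrr expr0n/= !(mulr0,mul0r) addr0.
  rewrite [leRHS](_ : _ = c i j * (b * (w i - w j) ^+ 2 * (E i + E j))); last by ring.
  apply: ler_wpM2l; first exact: c0.
  set s := w i - w j.
  have eb : expR (b * w i) = expR (b * w j) * expR (b * s).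
    by rewrite -expRD; congr expR; rewrite /s; ring.
  have e1 : expR (w i) = expR (w j) * expR s.
    by rewrite -expRD; congr expR; rewrite /s; ring.
  have Ej : E j = expR (b * w j) * expR (w j).
    by rewrite -expRD /E; congr expR; ring.
  have Ei : E i = E j * expR (b * s + s).
    by rewrite -expRD /E; congr expR; rewrite /s; ring.
  have h : 0 <= b * s * s by rewrite -mulrA mulr_ge0// -expr2 sqr_ge0.
  have := ler_wpM2l (expR_ge0 ((b + 1) * w j)) (mulr_expRB1_le h).
  rewrite -/(E j) Ei eb e1 Ej expr2; lra.
have {step}step : \sum_i \sum_j
    c i j * ((expR (b * w i) - expR (b * w j)) * (expR (w i) - expR (w j)))
    <= 2 * b * \sum_i E i * \sum_j c i j * (w i - w j) ^+ 2.
  apply: (le_trans (ler_sum _ (fun i _ => ler_sum _ (fun j _ => step i j)))).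
  under eq_bigr => i _ do rewrite big_split/= -!mulr_sumr.
  rewrite big_split/= -!mulr_sumr.
  rewrite [X in _ + b * X]exchange_big/=.
  rewrite -mulrA mulr_natl mulr2n; apply: lerD; rewrite ler_wpM2l//;
    apply: ler_sum => i _; rewrite mulr_sumr; apply: ler_sum => j _.
    by rewrite mulrC.
  by rewrite (cC j i) mulrC -[(w j - w i) ^+ 2]sqrrN opprB.
have {}step2 : \sum_i E i * \sum_j c i j * (w i - w j) ^+ 2 <= \sum_i E i * K.
  by apply: ler_sum => i _; rewrite ler_wpM2l ?expR_ge0.
rewrite /mean -[leLHS]mulrA [leRHS]mulrCA; apply: ler_wpM2l; first by rewrite invr_ge0.
rewrite -mulr_suml in step2.
rewrite ler_pdivrMr//; apply: le_trans step _.
have -> : b * K * (\sum_i expR ((b + 1) * w i)) * 2 =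
    2 * b * ((\sum_i E i) * K) by rewrite /E; ring.
by apply: ler_wpM2l => //; rewrite mulr_ge0.
Qed.

End Mean.

(** * From Beckner inequalities to Gaussian exponential moments *)

Section Herbst.
Variables (R : realType) (n : nat) (c : 'I_n -> 'I_n -> R) (a : R).
Hypotheses (n_gt0 : (0 < n)%N) (a_gt0 : 0 < a).
Hypotheses (c_sym : forall i j, c i j = c j i)
  (c_ge0 : forall i j, i != j -> 0 <= c i j)
  (c_sum0 : forall i, \sum_j c i j = 0).
Hypothesis beckner_c : forall p, 1 < p <= 2 ->
  exists2 al, a <= al & forall x : 'I_n -> R, (forall i, 0 < x i) ->
  al * hatp p * (mean (fun i => x i `^ p) - mean x `^ p)
  <= hatp p * p / 4 * chain_form c (fun i => x i `^ (p - 1)) x.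

Variables (z : 'I_n -> R) (G : R).
Hypothesis G_ge : forall i, \sum_j c i j * (z i - z j) ^+ 2 <= 2 * G.

Let M (s : R) := mean (fun i => expR (s * z i)).

Let M_gt0 s : 0 < M s.
Proof. by apply: mean_gt0 => // i; exact: expR_gt0. Qed.

Let G_ge0 : 0 <= G.
Proof.
have := G_ge (Ordinal n_gt0); set i := Ordinal _ => h.
suff : 0 <= \sum_j c i j * (z i - z j) ^+ 2 by lra.
apply: sumr_ge0 => j _; have [->|ij] := eqVneq i j.
  by rewrite subrr expr0n mulr0.
by rewrite mulr_ge0 ?c_ge0 ?sqr_ge0.
Qed.

(** If [M s <= M (s / p) `^ p] there is nothing to do. Otherwise the left-hand
    side of the Beckner inequality is positive, which allows its constant to be
    lowered to [a]. *)
Lemma mgf_contraction (p s : R) : 1 < p <= 2 ->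
  M s * (1 - (p - 1) * s ^+ 2 * G / (2 * a * p)) <= M (s / p) `^ p.
Proof.
move=> p12; have [al aal hb] := beckner_c p12.
have /andP[p1 p2] := p12.
have p0 : 0 < p by lra.
have pn0 : p != 0 by rewrite gt_eqF.
have M0 := ltW (M_gt0 s).
have e0 : 0 <= (p - 1) * s ^+ 2 * G / (2 * a * p).
  apply: divr_ge0; last by rewrite !mulr_ge0// ltW.
  by rewrite mulr_ge0// mulr_ge0 ?sqr_ge0//; lra.
have [le|gt] := leP (M s) (M (s / p) `^ p).
  apply: le_trans le; rewrite ler_piMr//; lra.
have hp : 0 < hatp p by rewrite divr_gt0//; lra.
pose w i := s / p * z i.
have := hb (fun i => expR (w i)) (fun i => expR_gt0 _).
have -> : mean (fun i => expR (w i) `^ p) = M s.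
  congr mean; apply/funext => i; rewrite -expRM; congr expR; rewrite /w; by field.
have -> : (fun i => expR (w i) `^ (p - 1)) = (fun i => expR ((p - 1) * w i)).
  by apply/funext => i; rewrite -expRM mulrC.
have -> : mean (fun i => expR (w i)) = M (s / p) by [].
move=> h.
have K i : \sum_j c i j * (w i - w j) ^+ 2 <= (s / p) ^+ 2 * (2 * G).
  under eq_bigr => j _ do rewrite /w -mulrBr exprMn mulrCA.
  by rewrite -mulr_sumr ler_wpM2l ?sqr_ge0.
have p10 : 0 <= p - 1 by lra.
have := chain_form_exp c_sym c_ge0 c_sum0 K p10.
have -> : mean (fun i => expR ((p - 1 + 1) * w i)) = M s.
  congr mean; apply/funext => i; congr expR; rewrite /w; by field.
move=> h2.
have h3 : hatp p * (al * (M s - M (s / p) `^ p)) <=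
    hatp p * (p / 4 * ((p - 1) * ((s / p) ^+ 2 * (2 * G)) * M s)).
  apply: le_trans (le_trans _ (ler_wpM2l _ h2)) _; last 2 first.
  - exact: (mulr_ge0 (ltW (mulr_gt0 hp p0)) (_ : 0 <= 4^-1)).
  - by rewrite !mulrA.
  by move: h; rewrite (mulrC al) -!mulrA.
rewrite ler_pM2l// in h3.
have h4 : a * (M s - M (s / p) `^ p) <= al * (M s - M (s / p) `^ p).
  by rewrite ler_wpM2r// subr_ge0 ltW.
have := le_trans h4 h3.
rewrite -ler_pdivlMl//.
have -> : a^-1 * (p / 4 * ((p - 1) * ((s / p) ^+ 2 * (2 * G)) * M s)) =
   M s * ((p - 1) * s ^+ 2 * G / (2 * a * p)).
  by field; rewrite pn0 gt_eqF.
lra.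
Qed.

(** With [e = (p - 1) s^2 G / (2 a p) <= 1/2], the factor [1 - e] is at least
    [exp (- 2 e)], and [2 e / s] is exactly [(G / a) (s - s / p)]: the errors
    telescope when the inequality is iterated. *)
Lemma ln_mgf_contraction (p s : R) : 1 < p <= 2 -> 0 < s ->
  (p - 1) * (s ^+ 2 * G) <= a ->
  ln (M s) / s - G / a * s <= ln (M (s / p)) / (s / p) - G / a * (s / p).
Proof.
move=> p12 s0 small; have := mgf_contraction s p12.
have /andP[p1 p2] := p12.
have p0 : 0 < p by lra.
set e := _ / (2 * a * p) => h.
have e0 : 0 <= e.
  apply: divr_ge0; last by rewrite !mulr_ge0// ltW.
  by rewrite mulr_ge0// mulr_ge0 ?sqr_ge0//; lra.
have e2 : e <= 2^-1.
  rewrite /e ler_pdivrMr ?mulr_gt0// -[X in X <= _]mulrA.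
  by apply: (le_trans small); rewrite !mulrA mulVf ?pnatr_eq0// mul1r ler_peMr// ltW//.
have h1 : M s * expR (- (2 * e)) <= M (s / p) `^ p.
  by apply: le_trans h; rewrite ler_wpM2l ?expRN_le1B// ltW.
have : ln (M s * expR (- (2 * e))) <= ln (M (s / p) `^ p).
  by rewrite ler_ln ?posrE ?powR_gt0//; apply: mulr_gt0 => //; exact: expR_gt0.
rewrite lnM ?posrE ?expR_gt0// expRK ln_powR => h2.
have h3 : ln (M s) <= 2 * e + p * ln (M (s / p)) by lra.
have : ln (M s) / s <= (2 * e + p * ln (M (s / p))) / s by rewrite ler_pM2r ?invr_gt0.
have -> : (2 * e + p * ln (M (s / p))) / s =
    ln (M (s / p)) / (s / p) + G / a * s - G / a * (s / p).
  by rewrite /e; field; rewrite !gt_eqF.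
lra.
Qed.

Hypothesis z_mean : mean z = 0.

(** The first-order term vanishes since [z] has mean zero; hence
    [ln (M s) / s] tends to 0 with [s]. *)
Lemma mgf_le1Dsq (l s : R) : 0 <= s <= l ->
  M s <= 1 + mean (fun i => z i ^+ 2 * expR (l * `|z i|)) * s ^+ 2.
Proof.
move=> /andP[s0 sl].
have -> : 1 + mean (fun i => z i ^+ 2 * expR (l * `|z i|)) * s ^+ 2 =
   mean (fun i => 1 + s * z i + s ^+ 2 * (z i ^+ 2 * expR (l * `|z i|))).
  by rewrite !meanD !meanZ mean1// z_mean mulr0 addr0 mulrC.
apply: le_mean => i; apply: (le_trans (expR_le1D_sq _)).
rewrite lerD2l exprMn -mulrA !ler_wpM2l ?sqr_ge0// ler_expR normrM ger0_norm//.
by rewrite ler_wpM2r.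
Qed.

Theorem mgf_le (l : R) : 0 < l -> M l <= expR (l ^+ 2 * G / a).
Proof.
move=> l0.
(* Any p in ]1, 2] with (p - 1) l^2 G <= a would do. *)
pose p := 1 + a / (a + l ^+ 2 * G).
have lG : 0 <= l ^+ 2 * G by rewrite mulr_ge0// sqr_ge0.
have D0 : 0 < a + l ^+ 2 * G by rewrite ltr_pwDl.
have p1 : 1 < p by rewrite ltrDl divr_gt0.
have p2 : p <= 2.
  suff : a / (a + l ^+ 2 * G) <= 1 by rewrite /p; lra.
  by rewrite ler_pdivrMr// mul1r lerDl.
have p0 : 0 < p by lra.
have small s : 0 <= s <= l -> (p - 1) * (s ^+ 2 * G) <= a.
  move=> /andP[s0 sl].
  have -> : p - 1 = a / (a + l ^+ 2 * G) by rewrite /p addrAC subrr add0r.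
  rewrite mulrAC ler_pdivrMr// ler_pM2l//.
  have : s ^+ 2 * G <= l ^+ 2 * G by rewrite ler_wpM2r// lerXn2r ?nnegrE// ltW.
  by move=> /le_trans; apply; rewrite lerDr ltW.
pose F s := ln (M s) / s - G / a * s.
pose C := mean (fun i => z i ^+ 2 * expR (l * `|z i|)).
have sk0 k : 0 < l * p^-1 ^+ k by rewrite mulr_gt0// exprn_gt0// invr_gt0.
have skl k : l * p^-1 ^+ k <= l.
  by rewrite ger_pMr// exprn_ile1 ?invr_ge0 ?invf_le1// ltW.
have iter k : F l <= F (l * p^-1 ^+ k).
  elim: k => [|k IH]; first by rewrite expr0 mulr1.
  apply: (le_trans IH); rewrite exprSr mulrA.
  by apply: ln_mgf_contraction => //; [rewrite p1 | apply: small; rewrite skl ltW].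
have bound s : 0 < s <= l -> F s <= C * s.
  move=> /andP[s0 sl].
  have h : M s <= 1 + C * s ^+ 2 by apply: mgf_le1Dsq; rewrite sl ltW.
  have C0 : 0 <= C.
    rewrite mulr_ge0 ?invr_ge0// sumr_ge0// => i _.
    by rewrite mulr_ge0 ?sqr_ge0 ?expR_ge0.
  have C1 : 0 <= C * s ^+ 2 by rewrite mulr_ge0 ?sqr_ge0.
  have h1 : ln (M s) <= C * s ^+ 2.
    apply: (@le_trans _ _ (ln (1 + C * s ^+ 2))).
      by rewrite ler_ln ?posrE//; lra.
    by apply: le_ln1Dx; lra.
  have : ln (M s) / s <= C * s by rewrite ler_pdivrMr// -mulrA -expr2.
  have : 0 <= G / a * s by rewrite mulr_ge0 ?divr_ge0// ltW.
  rewrite /F; lra.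
have lim0 : (C * (l * p^-1 ^+ k)) @[k --> \oo] --> (0 : R).
  rewrite -[X in _ --> X](mulr0 C); apply: cvgMr.
  rewrite -[X in _ --> X](mulr0 l); apply: cvgMr.
  by apply: cvg_expr; rewrite ger0_norm ?invr_ge0 ?invf_lt1// ltW.
have Fl : F l <= 0.
  rewrite -(cvg_lim _ lim0)//; apply: limr_ge; first by apply/cvg_ex; exists 0.
  apply: nearW => k; apply: (le_trans (iter k)); apply: bound.
  by rewrite sk0 skl.
have h : ln (M l) / l <= G / a * l by rewrite -subr_le0.
rewrite -ler_ln ?posrE ?expR_gt0// expRK.
move: h; rewrite ler_pdivrMr// => h; apply: (le_trans h).
rewrite le_eqVlt; apply/orP; left; apply/eqP.
by field; rewrite gt_eqF.
Qed.

End Herbst.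

(** * From exponential moments to tails *)

Section SubGaussian.
Variables (R : realType) (n : nat) (z : 'I_n -> R) (D : R).

Lemma mean_exp_abs_le (l : R) :
  mean (fun i => expR (l * z i)) <= expR (l ^+ 2 * D) ->
  mean (fun i => expR (l * - z i)) <= expR (l ^+ 2 * D) ->
  mean (fun i => expR (l * `|z i|)) <= 2 * expR (l ^+ 2 * D).
Proof.
move=> h1 h2; rewrite mulr_natl mulr2n.
apply: le_trans (lerD h1 h2); rewrite -meanD; apply: le_mean => i.
have [z0|z0] := leP 0 (z i); first by rewrite ger0_norm// lerDl expR_ge0.
by rewrite ltr0_norm// lerDr expR_ge0.
Qed.

Hypothesis exp_abs_le : forall l, 0 < l ->
  mean (fun i => expR (l * `|z i|)) <= 2 * expR (l ^+ 2 * D).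

Let tail (t : R) := mean (fun i => \1_(`[t, +oo[%classic) `|z i| : R).

Lemma tail_chernoff (t l : R) : 0 < l ->
  tail t <= 2 * expR (l ^+ 2 * D - l * t).
Proof.
move=> l0; rewrite expRD mulrA.
apply: le_trans (ler_wpM2r (expR_ge0 _) (exp_abs_le l0)).
rewrite mulrC -meanZ; apply: le_mean => i; rewrite -expRD indicE.
case: (boolP (_ \in _)) => [|_]; last exact: expR_ge0.
rewrite inE /= in_itv /= andbT => tz; rewrite -[leLHS]expR0 ler_expR.
by rewrite addrC subr_ge0 ler_pM2l.
Qed.

(** Chernoff's bound at the optimal exponent [t / (2 D)]. *)
Lemma tail_gaussian (t : R) : 0 < D -> 0 < t ->
  tail t <= 2 * expR (- (t ^+ 2 / (4 * D))).
Proof.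
move=> D0 t0; have l0 : 0 < t / (2 * D) by rewrite divr_gt0 ?mulr_gt0.
apply: (le_trans (tail_chernoff t l0)).
rewrite le_eqVlt; apply/orP; left; apply/eqP; congr (2 * expR _).
by field; rewrite gt_eqF.
Qed.

(** All exponential moments are at most 2, so that the tail is at most
    [2 exp (- l t)] for every [l]. *)
Lemma tail_degenerate (t : R) : D = 0 -> 0 < t -> tail t <= 0.
Proof.
move=> D0 t0; rewrite leNgt; apply/negP => T0.
(* At this exponent exp (l t) >= 1 + l t already exceeds 2 / tail t. *)
have l0 : 0 < 2 / (tail t * t) by apply: divr_gt0 (mulr_gt0 T0 t0).
have := tail_chernoff t l0; rewrite D0 mulr0 sub0r expRN.
rewrite ler_pdivlMr ?expR_gt0// => h.
have h1 := expR_ge1Dx (2 / (tail t * t) * t).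
have := le_trans (ler_wpM2l (ltW T0) h1) h.
have -> : tail t * (1 + 2 / (tail t * t) * t) = tail t + 2.
  by field; rewrite !gt_eqF.
by rewrite gerDr leNgt T0.
Qed.

End SubGaussian.

Local Open Scope complex_scope.
Local Open Scope sesquilinear_scope.

(** * Unitary diagonalization *)

Section UnitaryDiagonalization.
Variables (C : numClosedFieldType) (n : nat).
Implicit Types (U M A : 'M[C]_n) (d e : 'rV[C]_n).

Definition udiag U d : 'M[C]_n := U ^t* *m diag_mx d *m U.

(** The quadratic form of [M] at the i-th vector of the basis diagonalizing the
    [udiag U d]; this basis consists of the columns of [U ^t*]. *)
Definition dcoef U M (i : 'I_n) : C := (U *m M *m U ^t*) i i.

Lemma trmxC_mul p q r (A : 'M[C]_(p, q)) (B : 'M[C]_(q, r)) :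
  (A *m B) ^t* = B ^t* *m A ^t*.
Proof. by rewrite trmx_mul map_mxM. Qed.

Lemma unitary_mulVmx U : U \is unitarymx -> U ^t* *m U = 1%:M.
Proof. by rewrite -trmxC_unitary => /unitarymxP; rewrite trmxCK. Qed.

Lemma udiag_adj U d : (udiag U d) ^t* = udiag U (map_mx conjC d).
Proof. by rewrite /udiag !trmxC_mul trmxCK mulmxA tr_diag_mx map_diag_mx. Qed.

Lemma udiagM U d e : U \is unitarymx ->
  udiag U d *m udiag U e = udiag U (\row_i (d 0 i * e 0 i)).
Proof.
move=> Uu; rewrite /udiag -!mulmxA (mulmxA U) (unitarymxP Uu) mul1mx.
by congr (_ *m _); rewrite !mulmxA; congr (_ *m _); rewrite mulmx_diag.
Qed.

Lemma udiagB U d e : udiag U d - udiag U e = udiag U (d - e).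
Proof. by rewrite /udiag raddfB/= mulmxBr mulmxBl. Qed.

Lemma udiag_cst U (k : C) : U \is unitarymx -> udiag U (const_mx k) = k%:M.
Proof.
move=> Uu; rewrite /udiag diag_const_mx mul_mx_scalar -scalemxAl.
by rewrite unitary_mulVmx// scalemx1.
Qed.

Lemma udiag_normal U d : U \is unitarymx -> udiag U d \is normalmx.
Proof.
move=> Uu; apply/normalmxP; rewrite udiag_adj !udiagM//.
by congr udiag; apply/rowP => i; rewrite !mxE mulrC.
Qed.

(** [W i j] can only be nonzero where [d] and [e] agree, and there their images
    under [g] agree as well. *)
Lemma diag_intertwine (g : C -> C) d e (W : 'M[C]_n) :
  diag_mx d *m W = W *m diag_mx e ->
  diag_mx (map_mx g d) *m W = W *m diag_mx (map_mx g e).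
Proof.
move=> DW; apply/matrixP => i j; rewrite mul_diag_mx mul_mx_diag !mxE.
have := congr1 (fun B : 'M[C]_n => B i j) DW.
rewrite mul_diag_mx mul_mx_diag !mxE.
have [->|W0] := eqVneq (W i j) 0; first by rewrite !(mulr0, mul0r).
by rewrite [RHS]mulrC => /(mulIf W0) <-; rewrite mulrC.
Qed.

(** Functional calculus does not depend on the unitary used to diagonalize: two
    diagonalizations of [A] differ by a unitary intertwining their diagonals. *)
Lemma spectral_map_udiag (g : C -> C) U d (A := udiag U d) : U \is unitarymx ->
  invmx (spectralmx A) *m diag_mx (map_mx g (spectral_diag A)) *m spectralmx A
  = udiag U (map_mx g d).
Proof.
move=> Uu; have /orthomx_spectralP := udiag_normal d Uu; rewrite -/A.
set V := spectralmx A; set s := spectral_diag A => AE.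
have Vu : V \in unitmx by exact: spectral_unit.
pose W := U *m invmx V.
have DW : diag_mx d *m W = W *m diag_mx s.
  transitivity (U *m A *m invmx V).
    by rewrite /A /udiag !mulmxA (unitarymxP Uu) mul1mx.
  by rewrite AE /W !mulmxA mulmxK.
have UE : U = W *m V by rewrite mulmxKV.
rewrite /udiag [X in _ = _ *m X]UE [RHS]mulmxA -(mulmxA (U ^t*) _ W).
by rewrite (diag_intertwine g DW) /W !mulmxA unitary_mulVmx// mul1mx.
Qed.

Lemma hermitian_udiag A : A \is hermsymmx ->
  A = udiag (spectralmx A) (spectral_diag A).
Proof.
move=> Ah; have /orthomx_spectralP {1}-> := hermitian_normalmx Ah.
by rewrite /udiag invmx_unitary ?spectral_unitarymx.
Qed.

Lemma dcoefD U i M A : dcoef U (M + A) i = dcoef U M i + dcoef U A i.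
Proof. by rewrite /dcoef mulmxDr mulmxDl mxE. Qed.

Lemma dcoefZ U i k M : dcoef U (k *: M) i = k * dcoef U M i.
Proof. by rewrite /dcoef -scalemxAr -scalemxAl mxE. Qed.

Lemma dcoef_adj U i M : dcoef U (M ^t*) i = conjC (dcoef U M i).
Proof.
rewrite /dcoef -[U in LHS]trmxCK -!trmxC_mul trmxCK mulmxA.
by rewrite [LHS]mxE; congr conjC; rewrite [LHS]mxE.
Qed.

Lemma dcoef_udiag_mul U i d M : U \is unitarymx ->
  dcoef U (udiag U d *m M) i = d 0 i * dcoef U M i.
Proof.
move=> Uu; rewrite /dcoef /udiag !mulmxA (unitarymxP Uu) mul1mx.
by rewrite -!mulmxA mul_diag_mx [LHS]mxE.
Qed.

Lemma dcoef1 U i : U \is unitarymx -> dcoef U 1%:M i = 1.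
Proof. by move=> Uu; rewrite /dcoef mulmx1 (unitarymxP Uu) mxE eqxx. Qed.

Lemma mxtrace_dcoef U M : U \is unitarymx -> \tr M = \sum_i dcoef U M i.
Proof.
by move=> Uu; rewrite -[LHS]/(\tr M) -[M in LHS]mul1mx -(unitary_mulVmx Uu)
  -mulmxA mxtrace_mulC.
Qed.

Lemma udiag_sum U d :
  udiag U d = \sum_j d 0 j *: udiag U (delta_mx 0 j).
Proof.
rewrite /udiag; under eq_bigr => j _ do rewrite scalemxAl scalemxAr.
rewrite -mulmx_suml -mulmx_sumr; congr (_ *m _ *m _).
rewrite [in LHS](row_sum_delta d) linear_sum/=.
by apply: eq_bigr => j _; rewrite linearZ.
Qed.

Lemma udiag_form U d (v : 'cV[C]_n) :
  (v ^t* *m udiag U d *m v) 0 0 = \sum_i d 0 i * `|(U *m v) i 0| ^+ 2.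
Proof.
rewrite /udiag !mulmxA -trmxC_mul -mulmxA mul_mx_diag [LHS]mxE.
apply: eq_bigr => i _.
have -> (B : 'cV[C]_n) e : (\matrix_(k, l) (B ^t* k l * e 0 l)) 0 i =
    conjC (B i 0) * e 0 i by rewrite !mxE.
by rewrite normCK -mulrA mulrC -mulrA.
Qed.

Lemma dcoef_form U i M :
  dcoef U M i = ((col i (U ^t*)) ^t* *m M *m col i (U ^t*)) 0 0.
Proof.
rewrite /dcoef colE trmxC_mul trmxCK.
have -> : (delta_mx i 0 : 'cV[C]_n) ^t* = delta_mx 0 i.
  by rewrite trmx_delta map_delta_mx.
transitivity (((delta_mx 0 i : 'rV[C]_n) *m (U *m M *m U ^t*) *m
    delta_mx i (0 : 'I_1)) 0 0).
  by rewrite -rowE -colE [RHS]mxE [RHS]mxE.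
by rewrite !mulmxA.
Qed.

End UnitaryDiagonalization.

(** * Self-adjoint matrices in a fixed eigenbasis *)

Section RealSpectrum.
Variables (R : realType) (n : nat).
Notation C := R[i].
Implicit Types (U M A : 'M[C]_n) (x y : 'I_n -> R).

Lemma conjC_real (r : R) : conjC (r%:C : C) = r%:C.
Proof. by rewrite conj_Creal// complex_real. Qed.

Lemma Re_conjC (w : C) : complex.Re (conjC w) = complex.Re w.
Proof. by case: w. Qed.

Lemma Re_realM (r : R) (w : C) : complex.Re (r%:C * w) = r * complex.Re w.
Proof. by case: w => a b /=; rewrite mul0r subr0. Qed.

Lemma ReD (w v : C) : complex.Re (w + v) = complex.Re w + complex.Re v.
Proof. by case: w => a b; case: v. Qed.

Lemma Re_sum (I : Type) (r : seq I) (F : I -> C) :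
  complex.Re (\sum_(i <- r) F i) = \sum_(i <- r) complex.Re (F i).
Proof. exact: (big_morph (@complex.Re R) ReD). Qed.

Definition diag_in U x : 'M[C]_n := udiag U (\row_i (x i)%:C).

Lemma eq_diag_in U x y : x =1 y -> diag_in U x = diag_in U y.
Proof. by move=> /funext ->. Qed.

Lemma diag_in_adj U x : (diag_in U x) ^t* = diag_in U x.
Proof.
rewrite /diag_in udiag_adj; congr udiag; apply/rowP => i.
by rewrite [LHS]mxE !(mxE _ (fun _ _ => _)); exact: conjC_real.
Qed.

Lemma diag_inM U x y : U \is unitarymx ->
  diag_in U x *m diag_in U y = diag_in U (fun i => x i * y i).
Proof.
move=> Uu; rewrite /diag_in (udiagM _ _ Uu); congr (udiag U _); apply/rowP => i.
by rewrite !(mxE _ (fun _ _ => _)) rmorphM.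
Qed.

Lemma diag_in_cst U (r : R) : U \is unitarymx ->
  diag_in U (fun=> r) = (r%:C)%:M.
Proof.
move=> Uu; rewrite -(udiag_cst _ Uu); congr udiag; apply/rowP => i.
by rewrite !(mxE _ (fun _ _ => _)).
Qed.

Lemma diag_inB U x y :
  diag_in U x - diag_in U y = diag_in U (fun i => x i - y i).
Proof.
rewrite /diag_in udiagB; congr (udiag U _); apply/rowP => i.
by rewrite [LHS]mxE [in LHS]mxE !(mxE _ (fun _ _ => _)) rmorphB.
Qed.

Lemma fcalc_diag_in (f : R -> R) U x : U \is unitarymx ->
  fcalc f (diag_in U x) = diag_in U (fun i => f (x i)).
Proof.
move=> Uu; rewrite /fcalc /diag_in (spectral_map_udiag _ _ Uu).
by congr (udiag U _); apply/rowP => i; rewrite [LHS]mxE !(mxE _ (fun _ _ => _)).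
Qed.

Lemma hermitian_diag_in A : A \is hermsymmx ->
  A = diag_in (spectralmx A) (fun i => complex.Re (spectral_diag A 0 i)).
Proof.
move=> Ah; rewrite [LHS](hermitian_udiag Ah) /diag_in; congr (udiag _ _).
apply/rowP => i; rewrite (mxE _ (fun _ _ => _)).
by rewrite RRe_real//; have /mxOverP := hermitian_spectral_diag_real Ah; apply.
Qed.

Lemma absmx_diag_in U x : U \is unitarymx ->
  absmx (diag_in U x) = diag_in U (fun i => `|x i|).
Proof.
move=> Uu; rewrite /absmx diag_in_adj (diag_inM _ _ Uu) (fcalc_diag_in _ _ Uu).
by apply: eq_diag_in => i; rewrite -expr2 sqrtr_sqr.
Qed.

Definition dentry U M (i : 'I_n) : R := complex.Re (dcoef U M i).

Lemma dentryD U i M A : dentry U (M + A) i = dentry U M i + dentry U A i.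
Proof. by rewrite /dentry dcoefD ReD. Qed.

Lemma dentryZ U i (r : R) M : dentry U (r%:C *: M) i = r * dentry U M i.
Proof. by rewrite /dentry dcoefZ Re_realM. Qed.

Lemma dentryN U i M : dentry U (- M) i = - dentry U M i.
Proof. by rewrite -[RHS]mulN1r -dentryZ rmorphN rmorph1 scaleN1r. Qed.

Lemma dentryB U i M A : dentry U (M - A) i = dentry U M i - dentry U A i.
Proof. by rewrite dentryD dentryN. Qed.

Lemma dentry_sum U i (I : Type) (r : seq I) (F : I -> 'M[C]_n) :
  dentry U (\sum_(k <- r) F k) i = \sum_(k <- r) dentry U (F k) i.
Proof.
apply: (big_morph (fun M => dentry U M i)) => [M A|]; first exact: dentryD.
by rewrite -[LHS]addr0 -(subrr (dentry U 0 i)) addrA -dentryD addr0 subrr.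
Qed.

Lemma dentry_adj U i M : dentry U (M ^t*) i = dentry U M i.
Proof. by rewrite /dentry dcoef_adj Re_conjC. Qed.

Lemma dentry_diag_mul U i x M : U \is unitarymx ->
  dentry U (diag_in U x *m M) i = x i * dentry U M i.
Proof.
move=> Uu; rewrite /dentry /diag_in (dcoef_udiag_mul _ _ _ Uu).
by rewrite (mxE _ (fun _ _ => _)) Re_realM.
Qed.

Lemma dentry_diag_in U i x : U \is unitarymx -> dentry U (diag_in U x) i = x i.
Proof.
move=> Uu; rewrite -[diag_in U x]mulmx1 dentry_diag_mul//.
by rewrite /dentry (dcoef1 _ Uu) mulr1.
Qed.

Lemma mxtrace_dentry U M : U \is unitarymx ->
  complex.Re (\tr M) = \sum_i dentry U M i.
Proof. by move=> Uu; rewrite (mxtrace_dcoef _ Uu) Re_sum. Qed.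

Lemma ntrace_diag_mul U x M : U \is unitarymx ->
  ntrace (diag_in U x *m M) = mean (fun i => x i * dentry U M i).
Proof.
move=> Uu; rewrite /ntrace (mxtrace_dentry _ Uu); congr (_ * _).
by apply: eq_bigr => i _; rewrite dentry_diag_mul.
Qed.

Lemma ntrace_diag_in U x : U \is unitarymx -> ntrace (diag_in U x) = mean x.
Proof.
move=> Uu; rewrite /ntrace (mxtrace_dentry _ Uu); congr (_ * _).
by apply: eq_bigr => i _; rewrite dentry_diag_in.
Qed.

Lemma pnorm_diag_in (p : R) U x : 0 < p -> U \is unitarymx ->
  (forall i, 0 < x i) ->
  pnorm p (diag_in U x) `^ p = mean (fun i => x i `^ p).
Proof.
move=> p0 Uu x0; rewrite /pnorm (absmx_diag_in _ Uu) (fcalc_diag_in _ _ Uu).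
rewrite (ntrace_diag_in _ Uu).
rewrite -powRrM mulVf ?gt_eqF// powRr1.
  by congr mean; apply/funext => i; rewrite gtr0_norm.
by rewrite mulr_ge0 ?invr_ge0// sumr_ge0// => i _; exact: powR_ge0.
Qed.

Lemma pnorm1_diag_in U x : U \is unitarymx -> (forall i, 0 < x i) ->
  pnorm 1 (diag_in U x) = mean x.
Proof.
move=> Uu x0; rewrite -[LHS]powRr1; last exact: powR_ge0.
rewrite [LHS](pnorm_diag_in ltr01 Uu x0); congr mean.
by apply/funext => i; rewrite powRr1// ltW.
Qed.

Lemma mxtrace_diag_in U x : U \is unitarymx ->
  \tr (diag_in U x) = (\sum_i x i)%:C.
Proof.
move=> Uu; rewrite (mxtrace_dcoef _ Uu) rmorph_sum; apply: eq_bigr => i _.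
rewrite -[diag_in U x]mulmx1 /diag_in (dcoef_udiag_mul _ _ _ Uu).
by rewrite (dcoef1 _ Uu) mulr1 (mxE _ (fun _ _ => _)).
Qed.

Definition eigproj U (j : 'I_n) : 'M[C]_n := diag_in U (fun i => (i == j)%:R).

Lemma diag_in_sum U x : diag_in U x = \sum_j (x j)%:C *: eigproj U j.
Proof.
rewrite /diag_in udiag_sum; apply: eq_bigr => j _.
rewrite (mxE _ (fun _ _ => _)); congr (_ *: udiag _ _); apply/rowP => i.
by rewrite !(mxE _ (fun _ _ => _)) eqxx/= rmorph_nat.
Qed.

Lemma udiag_form_ge0 U x (v : 'cV[C]_n) i : 0 <= x i ->
  0 <= (\row_i (x i)%:C : 'rV[C]_n) 0 i * `|(U *m v) i 0| ^+ 2.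
Proof.
by move=> x0; rewrite (mxE _ (fun _ _ => _)) mulr_ge0 ?exprn_ge0// ler0c.
Qed.

Lemma diag_in_psd U x : (forall i, 0 <= x i) -> psdmx (diag_in U x).
Proof.
move=> x0 v; rewrite udiag_form; apply: sumr_ge0 => i _.
exact: udiag_form_ge0.
Qed.

Lemma diag_in_pd U x : U \is unitarymx -> (forall i, 0 < x i) ->
  pdmx (diag_in U x).
Proof.
move=> Uu x0 v v0; have h0 i := udiag_form_ge0 U v (ltW (x0 i)).
rewrite udiag_form lt_def sumr_ge0// andbT.
apply: contra_neq v0 => /eqP; rewrite psumr_eq0// => /allP h.
have Uv0 : U *m v = 0.
  apply/colP => i; have := h i (mem_index_enum _).
  rewrite (mxE _ (fun _ _ => _)) mulf_eq0 expf_eq0 normr_eq0 /=.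
  move=> /orP[/eqP[] xi|/eqP->]; last by rewrite mxE.
  by have := x0 i; rewrite xi ltxx.
by rewrite -[v]mul1mx -(unitary_mulVmx Uu) -mulmxA Uv0 mulmx0.
Qed.

Lemma dentry_psd_ge0 U i M : psdmx M -> 0 <= dentry U M i.
Proof.
move=> /(_ (col i (U ^t*))); rewrite -dcoef_form /dentry lecE.
by move=> /andP[].
Qed.

End RealSpectrum.

(** * Operator norm *)

Section OperatorNorm.
Variables (R : realType) (n : nat).
Notation C := R[i].
Implicit Types (U M A : 'M[C]_n) (v : 'cV[C]_n).

Lemma normc_ge0 (w : C) : 0 <= Normc.normc w.
Proof. by case: w => a b; exact: sqrtr_ge0. Qed.

Lemma normr_normcE (w : C) : `|w| = (Normc.normc w)%:C.
Proof. by []. Qed.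

Lemma normc_le_vnorm v i : Normc.normc (v i 0) <= vnorm v.
Proof.
rewrite -[leLHS]ger0_norm ?normc_ge0// -sqrtr_sqr ler_wsqrtr//.
by rewrite (bigD1 i)//= lerDl sumr_ge0// => j _; exact: sqr_ge0.
Qed.

Lemma vnorm_sqr v : (\sum_i Normc.normc (v i 0) ^+ 2)%:C = (v ^t* *m v) 0 0.
Proof.
have U1 : (1%:M : 'M[C]_n) \is unitarymx.
  by apply/unitarymxP; rewrite mul1mx trmx1 map_mx1.
have := udiag_form 1%:M (const_mx 1) v.
rewrite (udiag_cst _ U1) mulmx1 mul1mx => ->.
rewrite rmorph_sum; apply: eq_bigr => i _.
by rewrite mxE mul1r rmorphXn.
Qed.

(** The squared norm is the quadratic form of the identity, which a unitary
    preserves. *)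
Lemma vnorm_unitary U v : U \is unitarymx -> vnorm (U *m v) = vnorm v.
Proof.
move=> Uu; congr Num.sqrt; apply: (@complexI R).
by rewrite !vnorm_sqr trmxC_mul mulmxA -(mulmxA (v ^t*)) (unitary_mulVmx Uu) mulmx1.
Qed.

Lemma vnorm_delta (i : 'I_n) : vnorm (delta_mx i 0 : 'cV[C]_n) = 1.
Proof.
rewrite /vnorm (bigD1 i)//= big1 => [|j ji].
  by rewrite mxE !eqxx Normc.normc1 expr1n addr0 sqrtr1.
by rewrite mxE (negPf ji) Normc.normc0 expr0n.
Qed.

(** A supremum in a real type is meaningful only for a bounded set: the image of
    the unit ball is bounded in terms of the row sums of the moduli of the
    entries. *)
Lemma opnorm_ub A v : vnorm v <= 1 -> vnorm (A *m v) <= opnorm A.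
Proof.
move=> v1; apply: ub_le_sup; last by exists v.
exists (Num.sqrt (\sum_i (\sum_j Normc.normc (A i j)) ^+ 2)) => _ [w w1 <-].
apply: ler_wsqrtr; apply: ler_sum => i _; rewrite lerXn2r ?nnegrE ?normc_ge0//.
  by apply: sumr_ge0 => j _; exact: normc_ge0.
rewrite -lecR -normr_normcE mxE; apply: (le_trans (ler_norm_sum _ _ _)).
rewrite rmorph_sum; apply: ler_sum => j _.
rewrite normrM !normr_normcE -rmorphM lecR ler_piMr ?normc_ge0//.
exact: le_trans (normc_le_vnorm w j) w1.
Qed.

(** [dcoef U M i] is the i-th coordinate of [U *m (M *m v)] where [v], the i-th
    basis vector, has norm 1; and [U] is an isometry, so that a coordinate of
    [U *m (M *m v)] is at most the norm of [M *m v]. *)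
Lemma dentry_le_opnorm U M i : U \is unitarymx -> `|dentry U M i| <= opnorm M.
Proof.
move=> Uu; pose v := U ^t* *m (delta_mx i 0 : 'cV[C]_n).
have Vu : U ^t* \is unitarymx by rewrite trmxC_unitary.
have v1 : vnorm v = 1 by rewrite (vnorm_unitary _ Vu) vnorm_delta.
have vM : vnorm (M *m v) <= opnorm M by apply: opnorm_ub; rewrite v1.
apply: le_trans vM; rewrite -(vnorm_unitary _ Uu).
apply: le_trans (normc_le_vnorm _ i).
have -> : (U *m (M *m v)) i 0 = dcoef U M i by rewrite /v !mulmxA -colE mxE.
by rewrite -lecR -normr_normcE; exact: normc_ge_Re.
Qed.

End OperatorNorm.

(** * Positivity *)

Section Positivity.
Variables (R : realType).
Notation C := R[i].

Lemma psdmx_cast m n (e : m = n) (A : 'M[C]_m) :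
  psdmx (castmx (e, e) A) <-> psdmx A.
Proof. by case: n / e; rewrite castmx_id. Qed.

(** The one-block matrix has size [\sum_(i < 1) d], which equals [d] only up to a
    proof; hence the cast. *)
Lemma psdmx_block1 d (A : 'M[C]_d) :
  psdmx (\mxblock_(i < 1, j < 1) A) <-> psdmx A.
Proof.
rewrite -(psdmx_cast (big_ord1 _ (fun=> d))).
by rewrite -(mxEmxblock A).
Qed.

Lemma completely_positive_psd d (Phi : 'M[C]_d -> 'M[C]_d) (A : 'M[C]_d) :
  completely_positive Phi -> psdmx A -> psdmx (Phi A).
Proof.
move=> /(_ 1%N (fun _ _ => A)) h /psdmx_block1 A0.
by apply/psdmx_block1; exact: h.
Qed.

End Positivity.

(** * The Markov chain of a symmetric semigroup in an orthonormal basis *)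

Section EigenbasisChain.
Variables (R : realType) (d : nat).
Notation C := R[i].
Variables (P : R -> {linear 'M[C]_d -> 'M[C]_d}) (L : 'M[C]_d -> 'M[C]_d).
Hypotheses (P_qms : is_qms P) (L_gen : is_generator P L).
Hypothesis (P_sym : qms_symmetric P).
Variable U : 'M[C]_d.
Hypothesis U_unitary : U \is unitarymx.

Definition rate (i j : 'I_d) : R := dentry U (L (eigproj U j)) i.

Let quot (X : 'M[C]_d) i (t : R) : R :=
  t^-1 * (dentry U (P t X) i - dentry U X i).

(** The only way in which the generator is used: all properties of the rates are
    limits of properties of the semigroup at positive times. *)
Lemma dentry_gen_cvg (X : 'M[C]_d) i :
  quot X i t @[t --> 0^'+] --> dentry U (L X) i.
Proof.
apply/cvgrPdist_le => /= e e0; have /cvgrPdist_le /(_ e e0) := L_gen X.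
apply: filterS => t /=; rewrite sub0r normrN => h.
have <- : dentry U (L X - ((t^-1)%:C *: (P t X - X))) i
    = dentry U (L X) i - quot X i t.
  by rewrite dentryB dentryZ dentryB.
rewrite dentryB distrC -dentryB.
apply: (le_trans (dentry_le_opnorm _ _ U_unitary)).
exact: le_trans (ler_norm _) h.
Qed.

(** Linearity of [L] on the functions of a diagonal operator, inherited from the
    semigroup by uniqueness of limits. *)
Lemma dentry_gen_diag (x : 'I_d -> R) i :
  dentry U (L (diag_in U x)) i = \sum_j rate i j * x j.
Proof.
rewrite -(cvg_lim _ (@dentry_gen_cvg (diag_in U x) i))//; apply/cvg_lim => //.
have -> : quot (diag_in U x) i =
    fun t => \sum_j quot (eigproj U j) i t * x j.
  apply/funext => t; rewrite /quot (diag_in_sum U x) linear_sum !dentry_sum.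
  rewrite -sumrB mulr_sumr; apply: eq_bigr => j _.
  by rewrite -mulrA linearZ !dentryZ; ring.
apply: cvg_big => [|j _]; first exact: add_continuous.
by apply: cvgMl; exact: dentry_gen_cvg.
Qed.

Lemma dentry_eigproj i j : dentry U (eigproj U j) i = (i == j)%:R.
Proof. exact: dentry_diag_in. Qed.

(** At distinct [i] and [j] the entry of [eigproj U j] is 0 at time 0 and stays
    nonnegative. *)
Lemma rate_ge0 i j : i != j -> 0 <= rate i j.
Proof.
move=> ij; have h := @dentry_gen_cvg (eigproj U j) i.
rewrite /rate -(cvg_lim _ h)//; apply: limr_ge.
  by apply/cvg_ex; eexists; exact: h.
near=> t; have t0 : 0 < t by [].
rewrite /quot dentry_eigproj (negPf ij) subr0.
apply: mulr_ge0; first by rewrite invr_ge0 ltW.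
apply: dentry_psd_ge0.
apply: completely_positive_psd (qms_cp P_qms (ltW t0)) _.
by apply: diag_in_psd => k; rewrite ler0n.
Unshelve. all: by end_near. Qed.

(** The semigroup fixes the identity, which is the sum of the projections. *)
Lemma rate_sum0 i : \sum_j rate i j = 0.
Proof.
have -> : \sum_j rate i j = dentry U (L (diag_in U (fun=> 1))) i.
  by rewrite dentry_gen_diag; apply: eq_bigr => j _; rewrite mulr1.
have h := @dentry_gen_cvg (diag_in U (fun=> 1)) i.
rewrite -(cvg_lim _ h)//; apply: lim_near_cst => //.
near=> t; have t0 : 0 < t by [].
rewrite /quot (diag_in_cst _ U_unitary) (qms_unital P_qms (ltW t0)).
by rewrite subrr mulr0.
Unshelve. all: by end_near. Qed.

Lemma dentry_semigroup_sym (t : R) i j : 0 <= t ->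
  dentry U (P t (eigproj U j)) i = dentry U (P t (eigproj U i)) j.
Proof.
have tr k M : complex.Re (\tr (eigproj U k *m M)) = dentry U M k.
  rewrite (mxtrace_dentry _ U_unitary) (bigD1 k)//= big1 => [|l lk].
    by rewrite [dentry _ _ _](dentry_diag_mul k _ M U_unitary) eqxx mul1r addr0.
  by rewrite [LHS](dentry_diag_mul l _ M U_unitary) (negPf lk) mul0r.
move=> t0; have := P_sym t0 (eigproj U i) (eigproj U j).
rewrite [(eigproj U i) ^t*]diag_in_adj mxtrace_mulC => /(congr1 (@complex.Re R)).
by rewrite (tr j) (tr i) dentry_adj.
Qed.

Lemma rate_sym i j : rate i j = rate j i.
Proof.
rewrite {1}/rate -(cvg_lim _ (@dentry_gen_cvg (eigproj U j) i))//.
apply/cvg_lim => //.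
apply: cvg_trans (@dentry_gen_cvg (eigproj U i) j).
apply: near_eq_cvg; near=> t; have t0 : 0 < t by [].
rewrite /quot; congr (_ * (_ - _)).
  exact: dentry_semigroup_sym (ltW t0).
by rewrite [LHS]dentry_eigproj [RHS]dentry_eigproj eq_sym.
Unshelve. all: by end_near. Qed.

(** In the eigenbasis of [X] multiplication by [X] on either side acts on
    diagonal entries as multiplication by [x i], so that only [L X] and
    [L (X *m X)] matter; the zero row sums complete the square. *)
Lemma dentry_carre_du_champ (x : 'I_d -> R) i (X := diag_in U x) :
  dentry U (carre_du_champ L X X) i = 2^-1 * \sum_j rate i j * (x i - x j) ^+ 2.
Proof.
rewrite /carre_du_champ /X diag_in_adj (diag_inM _ _ U_unitary).
have -> : (2^-1 : C) = (2^-1 : R)%:C by rewrite fmorphV rmorph_nat.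
rewrite dentryZ !dentryB; congr (_ * _).
have e : dentry U (diag_in U x *m L (diag_in U x)) i =
    x i * \sum_j rate i j * x j.
  by rewrite (dentry_diag_mul i x _ U_unitary) dentry_gen_diag.
transitivity (\sum_j rate i j * (x j * x j) - x i * (\sum_j rate i j * x j)
    - x i * (\sum_j rate i j * x j)).
  congr (_ - _ - _); [exact: dentry_gen_diag | exact: e |].
  by rewrite -[LHS]dentry_adj trmxC_mul diag_in_adj trmxCK.
rewrite !mulr_sumr -!sumrN -!big_split/=.
transitivity (\sum_j rate i j * (x i - x j) ^+ 2 - (\sum_j rate i j) * x i ^+ 2).
  rewrite mulr_suml -sumrN -big_split; apply: eq_bigr => j _ /=; ring.
by rewrite rate_sum0 mul0r subr0.
Qed.

(** The Beckner inequality of the semigroup, restricted to positive functions of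
    a diagonal operator, is the one of the chain. *)
Lemma chain_beckner (p al : R) (x : 'I_d -> R) : 1 < p -> beckner p L al ->
  (forall i, 0 < x i) ->
  al * hatp p * (mean (fun i => x i `^ p) - mean x `^ p)
  <= hatp p * p / 4 * chain_form rate (fun i => x i `^ (p - 1)) x.
Proof.
move=> p1 bp x0; have h := bp _ (diag_in_pd U_unitary x0).
have p0 : 0 < p by apply: lt_trans p1.
have e1 := pnorm_diag_in p0 U_unitary x0.
have e2 := pnorm1_diag_in U_unitary x0.
have e3 : dirichlet_form p L (diag_in U x) =
    hatp p * p / 4 * chain_form rate (fun i => x i `^ (p - 1)) x.
  rewrite /dirichlet_form mulNr -mulrN; congr (_ * - _).
  rewrite (fcalc_diag_in _ x U_unitary) (ntrace_diag_mul _ _ U_unitary).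
  by congr mean; apply/funext => i; rewrite dentry_gen_diag.
by rewrite -e1 -e2 -e3.
Qed.

End EigenbasisChain.

(** * Concentration for self-adjoint operators *)

(** The linear bounds [e >= 2] and [kappa >= 2] already cover the factor
    between [G / a], the exponent of the Herbst bound, and [G / (4 a)]. *)
Lemma e_kappa_ge4 (R : realType) :
  4 <= expR 1 * (1 - expR (- 2^-1))^-1 :> R.
Proof.
have e2 : 2 <= expR 1 :> R by have := expR_ge1Dx (1 : R); lra.
have h := expR_ge1Dx (- 2^-1 : R).
have h1 : expR (- 2^-1) < 1 :> R by rewrite expR_lt1 oppr_lt0 invr_gt0.
rewrite ler_pdivlMr ?subr_gt0//; lra.
Qed.

Lemma centered_diag_in (R : realType) (d : nat) (U : 'M[R[i]]_d)
    (x : 'I_d -> R) : U \is unitarymx ->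
  diag_in U x - (d%:R^-1 * \tr (diag_in U x))%:M =
  diag_in U (fun i => x i - mean x).
Proof.
move=> Uu; rewrite (mxtrace_diag_in x Uu).
have -> : (d%:R^-1 * (\sum_i x i)%:C : R[i]) = (mean x)%:C.
  by rewrite /mean rmorphM fmorphV rmorph_nat.
by rewrite -(diag_in_cst _ Uu) diag_inB.
Qed.

Lemma primitive_dim_gt0 (R : realType) (d : nat)
  (P : R -> {linear 'M[R[i]]_d -> 'M[R[i]]_d}) : qms_primitive P -> (0 < d)%N.
Proof.
case=> sigma [[[_ tr1] _] _ _]; rewrite lt0n; apply/eqP => d0.
move: tr1; rewrite /mxtrace big1 => [|i _].
  by move=> /esym/eqP; rewrite oner_eq0.
by have d_gt0 := leq_ltn_trans (leq0n i) (ltn_ord i); rewrite d0 in d_gt0.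
Qed.

(** The Herbst bound for the chain of an eigenbasis, applied to the centered
    eigenvalues and to their opposites. *)
Lemma beckner_exp_moment (R : realType) (d : nat)
  (P : R -> {linear 'M[R[i]]_d -> 'M[R[i]]_d})
  (L : 'M[R[i]]_d -> 'M[R[i]]_d) (alpha : R -> R) (a : R)
  (U : 'M[R[i]]_d) (x : 'I_d -> R) (l : R) :
  is_qms P -> is_generator P L -> qms_symmetric P -> (0 < d)%N ->
  (forall p, 1 < p <= 2 -> beckner p L (alpha p)) ->
  (forall p, 1 < p <= 2 -> a <= alpha p) -> 0 < a -> U \is unitarymx -> 0 < l ->
  mean (fun i => expR (l * `|x i - mean x|)) <=
  2 * expR (l ^+ 2 * (opnorm (carre_du_champ L (diag_in U x) (diag_in U x)) / a)).
Proof.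
move=> P_qms L_gen P_sym d_gt0 L_b a_le a_gt0 Uu l0.
set G := opnorm _.
pose z i := x i - mean x.
have cS := rate_sym L_gen P_sym Uu.
have c0 i : \sum_j rate L U i j = 0 by exact: (rate_sum0 P_qms L_gen Uu).
have cP i j : i != j -> 0 <= rate L U i j by exact: (rate_ge0 P_qms L_gen Uu).
have hb p : 1 < p <= 2 -> exists2 al, a <= al &
    forall x : 'I_d -> R, (forall i, 0 < x i) ->
    al * hatp p * (mean (fun i => x i `^ p) - mean x `^ p)
    <= hatp p * p / 4 * chain_form (rate L U) (fun i => x i `^ (p - 1)) x.
  move=> p12; exists (alpha p); first exact: a_le.
  move=> y y0; have /andP[p1 _] := p12.
  exact: (chain_beckner L_gen Uu p1 (L_b _ p12) y0).
have hG i : \sum_j rate L U i j * (z i - z j) ^+ 2 <= 2 * G.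
  have h := le_trans (ler_norm _) (dentry_le_opnorm
    (carre_du_champ L (diag_in U x) (diag_in U x)) i Uu).
  rewrite (dentry_carre_du_champ P_qms L_gen Uu) in h.
  rewrite -ler_pdivrMl//; apply: le_trans h.
  rewrite ler_pM2l ?invr_gt0//; apply: ler_sum => j _.
  by rewrite (_ : z i - z j = x i - x j)// /z; ring.
have hGN i : \sum_j rate L U i j * (- z i - - z j) ^+ 2 <= 2 * G.
  under eq_bigr => j _ do rewrite -opprD sqrrN.
  exact: hG.
have z0 : mean z = 0.
  rewrite /z meanD.
  have -> : mean (fun _ : 'I_d => - mean x) = (- mean x) * mean (fun _ : 'I_d => 1).
    by rewrite -meanZ; congr mean; apply/funext => i; rewrite mulr1.
  by rewrite (mean1 R d_gt0) mulr1 subrr.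
have z0N : mean (fun i => - z i) = 0.
  by rewrite -[RHS]oppr0 -z0 /mean sumrN mulrN.
apply: mean_exp_abs_le; rewrite mulrA.
- exact: (mgf_le d_gt0 a_gt0 cS cP c0 hb hG z0 l0).
- exact: (mgf_le d_gt0 a_gt0 cS cP c0 hb hGN z0N l0).
Qed.

(* In the second bound, exp (- a t^2 / 0) is read as exp (-oo) = 0. *)
Theorem corollary3p37 (R : realType) (d : nat)
  (P : R -> {linear 'M[R[i]]_d -> 'M[R[i]]_d})
  (L : 'M[R[i]]_d -> 'M[R[i]]_d) (alpha : R -> R) (a : R)
  (P_qms : is_qms P) (L_gen : is_generator P L)
  (P_sym : qms_symmetric P) (P_prim : qms_primitive P)
  (L_beckner : forall p : R, 1 < p <= 2 -> beckner p L (alpha p))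
  (a_gt0 : 0 < a)
  (a_le_inf : (a%:E <= ereal_inf [set (alpha p)%:E | p in `]1%R, 2%R]%classic])%E) :
  let e : R := expR 1 in
  let kappa : R := (1 - expR (- 2^-1))^-1 in
  forall X : 'M[R[i]]_d, X \is hermsymmx ->
  let G := opnorm (carre_du_champ L X X) in
  let Y := absmx (X - (d%:R^-1 * \tr X)%:M) in
  pnorm 1 (fcalc expR Y) <= 2 * expR (e * kappa * G / (4 * a)) /\
  (forall t : R, 0 < t ->
     ntrace (fcalc \1_(`[t, +oo[%classic) Y)
     <= if G == 0 then 0 else 2 * expR (- (a * t ^+ 2 / (e * kappa * G)))).
Proof.
move=> e kappa X Xh G Y.
have d_gt0 := primitive_dim_gt0 P_prim.
have a_le p : 1 < p <= 2 -> a <= alpha p.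
  move=> p12; rewrite -lee_fin; apply: (le_trans a_le_inf).
  by apply: ereal_inf_lbound; exists p => //=; rewrite in_itv.
pose U := spectralmx X; pose x i := complex.Re (spectral_diag X 0 i).
have Uu : U \is unitarymx by exact: spectral_unitarymx.
have XE : X = diag_in U x by exact: hermitian_diag_in.
pose z i := x i - mean x.
have YE : Y = diag_in U (fun i => `|z i|).
  have BE : X - (d%:R^-1 * \tr X)%:M = diag_in U z.
    by rewrite XE; exact: (centered_diag_in x Uu).
  by rewrite /Y BE; exact: (absmx_diag_in z Uu).
have ek4 : 4 <= e * kappa := e_kappa_ge4 R.
have G_ge0 : 0 <= G.
  exact: le_trans (normr_ge0 _) (dentry_le_opnorm _ (Ordinal d_gt0) Uu).
pose D := e * kappa * G / (4 * a).
have D_ge : G / a <= D.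
  rewrite /D invfM mulrA ler_pM2r ?invr_gt0// ler_pdivlMr// mulrC.
  by rewrite ler_wpM2r.
have exp_le l : 0 < l ->
    mean (fun i => expR (l * `|z i|)) <= 2 * expR (l ^+ 2 * D).
  move=> l0.
  apply: (le_trans (beckner_exp_moment x P_qms L_gen P_sym d_gt0
    L_beckner a_le a_gt0 Uu l0)).
  by rewrite -XE ler_pM2l// ler_expR ler_wpM2l ?sqr_ge0.
split.
  rewrite YE (fcalc_diag_in _ _ Uu) (pnorm1_diag_in Uu); last first.
    by move=> i; exact: expR_gt0.
  have := exp_le 1 ltr01; rewrite expr1n mul1r; apply: le_trans.
  by apply: le_mean => i; rewrite mul1r.
move=> t t0; rewrite YE (fcalc_diag_in _ _ Uu) (ntrace_diag_in _ Uu).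
have [G0|G0] := eqVneq G 0.
  have D0 : D = 0 by rewrite /D G0 mulr0 mul0r.
  exact: (tail_degenerate exp_le D0 t0).
have Gp : 0 < G by rewrite lt_def G0.
have ekp : 0 < e * kappa by apply: lt_le_trans ek4.
have D0 : 0 < D by apply: divr_gt0; exact: mulr_gt0.
have -> : a * t ^+ 2 / (e * kappa * G) = t ^+ 2 / (4 * D).
  by rewrite /D; move: (e * kappa) ekp => k k0; field; rewrite !gt_eqF.
exact: (tail_gaussian exp_le D0 t0).
Qed.
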